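(* For every function $\varepsilon(n)\ge 0$ and every constant $c>0$, $\mathsf{P}\text{-}\mathsf{RSLOCAL}(\varepsilon(n))\subseteq \mathsf{P}\text{-}\mathsf{RLOCAL}(\varepsilon(n)+1/n^c)$.
   Context: Distributed graph problems: the input graph $G=(V,E)$ with $n$ nodes is also the communication network; nodes have unique identifiers (of $O(\log n)$ bits) and possibly local inputs, and each node must produce a local output; the problem specifies which collections of outputs are valid. LOCAL model: computation proceeds in synchronous rounds; in each round every node performs arbitrary local computation, sends a message of arbitrary size to each neighbor and receives its neighbors' messages. SLOCAL model: the nodes are processed sequentially in an arbitrary order; when a node $v$ is processed, it can read the current state of all nodes in its $r$-hop neighborhood (their initial inputs and everything stored by previously processed nodes), and computes its output as an arbitrary function of this; it may additionally store an arbitrary amount of information in its own state, readable by later processed nodes. $r$ is the locality. In randomized versions, nodes additionally have access to private random bits. $\mathsf{RLOCAL}(t,\varepsilon)$ is the class of problems solvable by a randomized Monte Carlo algorithm in the LOCAL model in at most $t$ rounds with error probability at most $\varepsilon$; $\mathsf{RSLOCAL}(t,\varepsilon)$ is the analogous class for randomized SLOCAL algorithms with locality at most $t$ (for every processing order). $\mathsf{P}\text{-}\mathsf{RLOCAL}(\varepsilon) := \mathsf{RLOCAL}(\log^{O(1)}n,\varepsilon)$ and $\mathsf{P}\text{-}\mathsf{RSLOCAL}(\varepsilon) := \mathsf{RSLOCAL}(\log^{O(1)}n,\varepsilon)$. *)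

(* Defs.v *)
From HB Require Import structures.
From mathcomp Require Import all_boot all_order all_algebra.
From mathcomp Require Import all_classical all_reals all_analysis.
From mathcomp Require Import zify.

Set Implicit Arguments.
Unset Strict Implicit.
Unset Printing Implicit Defensive.

Import Order.TTheory GRing.Theory Num.Theory.
Import numFieldNormedType.Exports.
Local Open Scope classical_set_scope.
Local Open Scope ring_scope.

Record sgraph := SGraph {
  vert :> finType;
  adj : rel vert;
  adj_sym : symmetric adj;
  adj_irr : irreflexive adj;
  vert_gt0 : (0 < #|vert|)%N
}.

(* [(trunc_log 2 n).+1] is the binary length of [n]; the constant hidden in
   "identifiers of O(log n) bits" is the parameter [b]. *)
Definition identifiers (b : nat) (G : sgraph) (id : G -> nat) : Prop :=
  injective id /\ forall v, (id v < 2 ^ (b * (trunc_log 2 #|G|).+1))%N.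

Record problem := Problem {
  p_in : Type;
  p_out : Type;
  p_valid : forall G : sgraph, (G -> p_in) -> (G -> p_out) -> Prop
}.

Definition fair_coins (R : realType) (I : eqType) (d : measure_display)
    (Omega : measurableType d) (P : probability Omega R)
    (coin : I -> Omega -> bool) : Prop :=
  (forall i, measurable_fun setT (coin i)) /\
  forall (D : seq I) (s : I -> bool), uniq D ->
    P [set o | forall i, i \in D -> coin i o = s i] = ((2^-1) ^+ size D)%:E.

Lemma count_digits (D : {pred nat}) (s : nat -> bool) (N : nat) :
  (count (fun m => all (fun i => (i \in D) ==> (odd (m %/ 2 ^ (N.-1 - i)) == s i)) (iota 0 N))
     (iota 0 (2 ^ N)) * 2 ^ count (mem D) (iota 0 N) = 2 ^ N)%N.
Proof.
pose q N m := all (fun i => (i \in D) ==> (odd (m %/ 2 ^ (N.-1 - i)) == s i)) (iota 0 N).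
rewrite -/(q N).
elim: N => [|N IHN]; first by [].
have qS m : q N.+1 m = ((N \in D) ==> (odd m == s N)) && q N m./2.
  rewrite /q -[N.+1]addn1 iotaD all_cat /= andbT add0n addn1 /= subnn expn0 divn1 andbC.
  congr (_ && _); apply: eq_in_all => i; rewrite mem_iota add0n => /andP[_ iN].
  by rewrite -divn2 -divnMA -expnS; congr (_ ==> (odd (_ %/ 2 ^ _) == _)); lia.
have cS K : count (q N.+1) (iota 0 (2 * K)) =
            ((if N \in D then 1 else 2) * count (q N) (iota 0 K))%N.
  elim: K => [|K IHK]; first by rewrite !muln0.
  rewrite mulnS addnC [in LHS]iotaD -[K.+1]addn1 iotaD !count_cat IHK /= !add0n !qS.
  rewrite !addn0 oddS oddM /= mulnDr; congr addn.
  have -> : (2 * K)./2 = K by lia.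
  have -> : (uphalf (2 * K) = K)%N by lia.
  by case: (N \in D); case: (s N); case: (q N K).
have -> : count (mem D) (iota 0 N.+1) = (count (mem D) (iota 0 N) + (N \in D))%N.
  by rewrite -[N.+1]addn1 iotaD count_cat /= add0n addn0.
rewrite expnD expnS cS -[in RHS]IHN; case: (N \in D) => /=.
  by rewrite expn1 mul1n [(2 ^ _ * 2)%N]mulnC mulnCA.
by rewrite expn0 muln1 mulnA.
Qed.

Lemma uniform_grid (R : realType) (q : pred nat) (K : nat) : (0 < K)%N ->
  measurable [set x : R | q (Num.truncn (K%:R * x))] /\
  uniform_prob (@ltr01 R) [set x : R | q (Num.truncn (K%:R * x))] =
  ((count q (iota 0 K))%:R / K%:R)%:E.
Proof.
move=> K0; have KR : 0 < K%:R :> R by rewrite ltr0n.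
pose J (m : nat) : set R := `[m%:R / K%:R, m.+1%:R / K%:R[%classic.
have JE m x : J m x <-> 0 <= x /\ Num.truncn (K%:R * x) = m.
  rewrite /J /= in_itv /= ler_pdivrMr // ltr_pdivlMr // mulrC; split.
    move=> h; have x0 : 0 <= x.
      by case/andP: h => h _; rewrite -(pmulr_rge0 _ KR); apply: le_trans h.
    by split=> //; apply: truncn_def.
  move=> [x0 <-]; apply: truncn_itv; exact: mulr_ge0 (ltW KR) x0.
have mJ m : measurable (J m) by exact: measurable_itv.
have PJ m : (m < K)%N -> uniform_prob (@ltr01 R) (J m) = (K%:R^-1)%:E.
  move=> mK; rewrite /uniform_prob (eq_integral (fun=> 1%:E)).
    rewrite integral_cst; last exact: mJ.
    rewrite mul1e /J; etransitivity; first exact: lebesgue_measure_itv.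
    rewrite /= lte_fin ltr_pM2r ?invr_gt0 // ltr_nat ltnSn -EFinD -mulrBl.
    by rewrite -natrB // subSnn mul1r.
  move=> x; rewrite inE => /JE[x0 xm]; rewrite /uniform_pdf x0 subr0 invr1.
  have : (Num.truncn (K%:R * x) < K)%N by rewrite xm.
  rewrite truncn_lt_nat ?mulr_ge0 ?ler0n // gtr_pMr // => x1.
  by rewrite (ltW x1).
have tJ : trivIset setT J.
  by move=> i j _ _ [x [/JE[_ <-] /JE[_ <-]]].
have mq : measurable [set x : R | q (Num.truncn (K%:R * x))].
  have -> : [set x : R | q (Num.truncn (K%:R * x))] =
     (if q 0%N then `]-oo, 0[%classic else set0) `|` \bigcup_(m in [set m | q m]) J m.
    apply/seteqP; split => x /=.
      case: (leP 0 x) => x0 qx; first by right; exists (Num.truncn (K%:R * x)) => //; apply/JE.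
      move: qx; have -> : Num.truncn (K%:R * x) = 0%N.
        by apply/truncn0Pn; rewrite -ltNge; apply: lt_trans ltr01; rewrite pmulr_rlt0.
      by move=> ->; left; rewrite /= in_itv /=.
    case=> [|[m /= qm /JE[_ ->]]] //.
    case: ifP => // q0; rewrite /= in_itv /= => x0.
    have -> // : Num.truncn (K%:R * x) = 0%N.
    by apply/truncn0Pn; rewrite -ltNge; apply: lt_trans ltr01; rewrite pmulr_rlt0.
  apply: measurableU; first by case: ifP => _; [exact: measurable_itv|exact: measurable0].
  by apply: bigcup_measurable => m _; exact: mJ.
split=> //.
pose U (p : pred nat) := \big[setU/set0]_(m < K | p m) J m.
have PU p : uniform_prob (@ltr01 R) (U p) = ((count p (iota 0 K))%:R / K%:R)%:E.
  rewrite /U measure_bigsetU_ord_cond //; last first.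
    by move=> i j _ _ h; apply/ord_inj/tJ.
    by move=> i _; exact: mJ.
  rewrite (eq_bigr (fun=> (K%:R^-1)%:E)); last by move=> m _; exact: PJ.
  rewrite sumEFin; congr (_%:E).
  rewrite sumr_const mulr_natl; congr (_ *+ _).
  rewrite -sum1_card -sum1_count.
  have := big_mkord p (fun=> 1%N) (idx := 0%N) (op := addn) (n := K).
  by rewrite /index_iota subn0 => ->.
have mU p : measurable (U p) by apply: bigsetU_measurable.
have PT : uniform_prob (@ltr01 R) (~` U predT) = 0.
  have h := probability_setC (uniform_prob (@ltr01 R)) (mU predT).
  rewrite [LHS]h [X in (_ - X)%E]PU count_predT size_iota divff ?gt_eqF //.
  by rewrite subee.
have UE p x : U p x <-> (U predT x /\ p (Num.truncn (K%:R * x))).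
  rewrite /U -!bigcup_seq_cond; split.
    move=> [m /= /andP[mK pm] Jx]; have [_ h] := (JE m x).1 Jx.
    by split; [exists m => //=; rewrite mK|rewrite h].
  move=> [[m /= /andP[mK _] Jx]]; have [_ ->] := (JE m x).1 Jx.
  by move=> pm; exists m => //=; rewrite mK.
set S := [set x : R | _] in mq *.
have SE : S = (S `&` U predT) `|` (S `&` ~` U predT) by rewrite -setIUr setUv setIT.
have mC : measurable (S `&` ~` U predT) by apply: measurableI => //; exact: measurableC.
have mSU : measurable (S `&` U predT) by apply: measurableI.
rewrite SE; etransitivity.
  apply: (measureU (uniform_prob (@ltr01 R)) mSU mC).
  by rewrite setIACA setICr setI0.
have C0 : uniform_prob (@ltr01 R) (S `&` ~` U predT) = 0%E.
  apply: (subset_measure0 (mu := uniform_prob (@ltr01 R)) mC _ _ PT); last exact: subIsetr.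
  by apply: measurableC; exact: mU.
rewrite [X in (_ + X)%E]C0 adde0 -PU; congr uniform_prob; apply/seteqP; split => x.
  by move=> [qx Ux]; apply/UE.
by case/UE.
Qed.

(* Such coins exist: the binary digits of a uniform real number in [0, 1]. *)
Lemma fair_coins_exist (R : realType) (I : countType) :
  exists coin : I -> R -> bool, fair_coins (uniform_prob (@ltr01 R)) coin.
Proof.
exists (fun i x => odd (Num.truncn ((2 ^ (pickle i).+1)%N%:R * x))); split.
  move=> i; apply: (measurable_fun_bool true); rewrite setTI.
  have [h _] := @uniform_grid R odd (2 ^ (pickle i).+1) (expn_gt0 2 _).
  exact: h.
move=> D s uD; pose E := [seq pickle i | i <- D].
pose N := (\max_(e <- E) e).+1.
pose s' e := if unpickle e is Some i then s i else false.
pose q m := all (fun i => (i \in E) ==> (odd (m %/ 2 ^ (N.-1 - i)) == s' i)) (iota 0 N).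
have EN e : e \in E -> (e < N)%N by move=> eE; rewrite ltnS; exact: leq_bigmax_seq.
have -> : [set o : R | forall i, i \in D ->
     odd (Num.truncn ((2 ^ (pickle i).+1)%N%:R * o)) = s i] =
   [set x : R | q (Num.truncn ((2 ^ N)%N%:R * x))].
  have dig e (x : R) : (e < N)%N -> Num.truncn ((2 ^ e.+1)%N%:R * x) =
      (Num.truncn ((2 ^ N)%N%:R * x) %/ 2 ^ (N.-1 - e))%N.
    move=> eN; have eqN : (2 ^ N = 2 ^ (N.-1 - e) * 2 ^ e.+1)%N by rewrite -expnD; congr (2 ^ _)%N; lia.
    case: (ltP x 0) => x0.
      have z K : (0 < K)%N -> Num.truncn (K%:R * x) = 0%N.
        by move=> K0; apply/truncn0Pn; rewrite -ltNge; apply: lt_trans ltr01; rewrite pmulr_rlt0 ?ltr0n.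
      by rewrite !z ?expn_gt0 // div0n.
    apply: truncn_def; rewrite eqN natrM -mulrA; set y := _ * x.
    have y0 : 0 <= y by rewrite mulr_ge0.
    set k := (2 ^ (N.-1 - e))%N; have k0 : (0 < k)%N by rewrite expn_gt0.
    have kR : 0 < k%:R :> R by rewrite ltr0n.
    have [/andP[h1 h2]] := (truncn_itv (mulr_ge0 (ltW kR) y0)).
    set m := Num.truncn _ in h1 h2 *.
    rewrite -(ler_pM2l kR) -(ltr_pM2l kR y) -!natrM; apply/andP; split.
      by apply: le_trans h1; rewrite ler_nat mulnC leq_divM.
    by apply: lt_le_trans h2 _; rewrite ler_nat mulnC ltn_ceil.
  apply/seteqP; split=> x /= h.
    apply/allP => e; rewrite mem_iota add0n => /= eN; apply/implyP => /mapP[i iD ei].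
    by rewrite -dig // ei h // /s' pickleK.
  move=> i iD; have iE : pickle i \in E by exact: map_f.
  have /allP/(_ (pickle i)) := h; rewrite mem_iota /= add0n EN // iE /= => /(_ isT) /eqP.
  by rewrite -dig ?EN // /s' pickleK.
have [_ h] := @uniform_grid R q (2 ^ N) (expn_gt0 2 _); etransitivity; first exact: h.
have := count_digits (mem E) s' N; rewrite -/(q _).
have -> : count (mem (mem E)) (iota 0 N) = size D.
  rewrite -(size_map pickle D) -/E -size_filter; apply: perm_size; apply: uniq_perm.
  - by apply: filter_uniq; exact: iota_uniq.
  - by rewrite map_inj_uniq //; exact: (pcan_inj pickleK).
  - move=> e; rewrite mem_filter mem_iota /= add0n.
    by case eE: (e \in E) => //=; rewrite EN.
move=> cE; congr (_%:E); have := expn_gt0 2 N; rewrite -{1 3}cE muln_gt0 => /andP[a0 _].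
rewrite natrM natrX exprVn invfM mulrA divff ?mul1r //.
by rewrite gt_eqF // ltr0n.
Qed.

(* The event [F], which depends on independent fair coins indexed by [I], has
   probability at most [e].  The joint law of the coins is determined by
   [fair_coins], so the choice of the sample space is immaterial.  Local
   computations are arbitrary functions of the coins, hence [F] need not be
   measurable: it is then required to lie in an event of probability at most
   [e], which for a measurable [F] amounts to [P F <= e]. *)
Definition prob_le (R : realType) (I : eqType) (F : set (I -> bool)) (e : R)
    : Prop :=
  forall (d : measure_display) (Omega : measurableType d)
    (P : probability Omega R) (coin : I -> Omega -> bool),
  fair_coins P coin ->
  exists2 B : set Omega,
    measurable B /\ [set o | F (coin^~ o)] `<=` B & (P B <= e%:E)%E.

(* A node initially knows the number of nodes, its own identifier, its input
   and its private random bits.  [l_send s j] is the message sent to the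
   neighbour with identifier [j], if there is one (the sender need not know
   whether there is), and [l_recv] gets the incoming messages indexed by the
   identifiers of their senders.  As messages are unbounded, this has the same
   power as addressing neighbours through port numbers. *)
Record local_alg (X Y : Type) := LocalAlg {
  l_state : Type;
  l_msg : Type;
  l_rounds : nat -> nat;
  l_init : nat -> nat -> X -> (nat -> bool) -> l_state;
  l_send : l_state -> nat -> l_msg;
  l_recv : l_state -> (nat -> option l_msg) -> l_state;
  l_out : l_state -> Y
}.

Section LocalExecution.
Variables (X Y : Type) (A : local_alg X Y).
Variables (G : sgraph) (id : G -> nat) (x : G -> X) (w : G * nat -> bool).

Definition inbox (s : G -> l_state A) (v : G) (j : nat) : option (l_msg A) :=
  omap (fun u => l_send (s u) (id v)) [pick u | adj v u & id u == j].

Fixpoint local_states (k : nat) : G -> l_state A :=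
  match k with
  | 0 => fun v => l_init A #|G| (id v) (x v) (fun i => w (v, i))
  | k'.+1 => let s := local_states k' in fun v => l_recv (s v) (inbox s v)
  end.

Definition local_output (v : G) : Y :=
  l_out (local_states (l_rounds A #|G|) v).

End LocalExecution.

Definition within (G : sgraph) (r : nat) (v u : G) : bool :=
  `[< exists p : seq G,
        [/\ path (@adj G) v p, last v p = u & (size p <= r)%N] >].

(* What a node sees, with nodes named by their identifiers: the input and the
   stored information ([None] for a node not processed yet) of the visible
   nodes, and the edges between them. *)
Record view (X S : Type) := View {
  view_node : nat -> option (X * option S);
  view_edge : rel nat
}.

Definition ball_view (X S : Type) (G : sgraph) (id : G -> nat) (x : G -> X)
    (mem : G -> option S) (r : nat) (v : G) : view X S :=
  View (fun j => omap (fun u => (x u, mem u))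
                      [pick u | within r v u & id u == j])
       (fun i j => [exists u, exists u',
          [&& within r v u, within r v u', adj u u', id u == i & id u' == j]]).

(* [s_step n i bits vw] is the information stored and the output produced by
   the node with identifier [i] and private random bits [bits]. *)
Record slocal_alg (X Y : Type) := SLocalAlg {
  s_store : Type;
  s_locality : nat -> nat;
  s_step : nat -> nat -> (nat -> bool) -> view X s_store -> s_store * Y
}.

Section SLocalExecution.
Variables (X Y : Type) (A : slocal_alg X Y).
Variables (G : sgraph) (id : G -> nat) (x : G -> X) (w : G * nat -> bool).

Definition slocal_process (mem : G -> option (s_store A * Y)) (v : G)
    : G -> option (s_store A * Y) :=
  fun u =>
    if u == v then
      Some (s_step #|G| (id v) (fun i => w (v, i))
              (ball_view id x (fun u' => omap fst (mem u'))
                 (s_locality A #|G|) v))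
    else mem u.

Definition slocal_run (order : seq G) : G -> option (s_store A * Y) :=
  foldl slocal_process (fun=> None) order.

Definition slocal_outputs (order : seq G) (y : G -> Y) : Prop :=
  forall v, omap snd (slocal_run order v) = Some (y v).

End SLocalExecution.

Section Classes.
Variable R : realType.
Implicit Types (b : nat) (t : nat -> nat) (eps : nat -> R).

Definition RLOCAL b t eps (P : problem) : Prop :=
  exists A : local_alg (p_in P) (p_out P),
    (forall n, (l_rounds A n <= t n)%N) /\
    forall (G : sgraph) (id : G -> nat) (x : G -> p_in P),
      identifiers b id ->
      prob_le [set w : G * nat -> bool | ~ p_valid x (local_output A id x w)]
              (eps #|G|).

Definition RSLOCAL b t eps (P : problem) : Prop :=
  exists A : slocal_alg (p_in P) (p_out P),
    (forall n, (s_locality A n <= t n)%N) /\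
    forall (G : sgraph) (id : G -> nat) (x : G -> p_in P) (order : seq G),
      identifiers b id -> perm_eq order (enum G) ->
      prob_le [set w : G * nat -> bool |
                 ~ exists2 y : G -> p_out P,
                     slocal_outputs A id x w order y & p_valid x y]
              (eps #|G|).

(* t(n) = log^{O(1)} n *)
Definition polylog t : Prop :=
  exists k : nat, \forall n \near \oo, (t n)%:R <= (ln n%:R : R) ^+ k.

Definition P_RLOCAL b eps (P : problem) : Prop :=
  exists2 t, polylog t & RLOCAL b t eps P.

Definition P_RSLOCAL b eps (P : problem) : Prop :=
  exists2 t, polylog t & RSLOCAL b t eps P.

End Classes.

(* Main.v *)
(* An SLOCAL run along an order given by integer keys is local in the
   following sense: the output at [v] only depends on the nodes at the end
   of key-decreasing chains from [v] whose steps have length at most the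
   locality [r]. It thus suffices to compute, in polylogarithmically many
   rounds, keys all of whose decreasing chains stay within a polylogarithmic
   distance: every node then gathers that ball and runs the SLOCAL algorithm
   in it. The keys are pairs (color, identifier) for a network decomposition
   of the r-th power of the graph in the style of Linial and Saks. In each
   of [M] = O(log n) phases every node draws a geometric radius, given by
   its number of leading ones in [M] coins; [y] selects the node of largest
   identifier that reaches it, and joins its cluster if it lies strictly
   inside the ball. The coin deciding this has not been read by the
   selection, so that [y] fails in all phases with probability exactly [2 ^
   - M]. The SLOCAL algorithm uses the even coins and the decomposition the
   odd ones; its guarantee is applied conditionally on each value of the odd
   coins, that is, for a fixed order. *)

Require Import Defs.
From mathcomp Require Import all_boot all_order all_algebra.
From mathcomp Require Import all_classical all_reals all_analysis.
From mathcomp Require Import zify.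

Set Implicit Arguments.
Unset Strict Implicit.
Unset Printing Implicit Defensive.

Import Order.TTheory GRing.Theory Num.Theory.
Import numFieldNormedType.Exports.
Local Open Scope ring_scope.

Local Notation within := Defs.within.

(** * Indistinguishability in the LOCAL model *)

Section Within.
Variable G : sgraph.
Implicit Types (a b r : nat) (u v : G).

Lemma withinP r v u :
  reflect (exists p : seq G,
             [/\ path (@adj G) v p, last v p = u & (size p <= r)%N])
          (within r v u).
Proof. exact: asboolP. Qed.

Lemma within_refl r v : within r v v.
Proof. by apply/withinP; exists [::]. Qed.

Lemma within0 v u : within 0 v u -> v = u.
Proof. by case/withinP => -[|? ?] []. Qed.

Lemma within_leq a b v u : (a <= b)%N -> within a v u -> within b v u.
Proof.
by move=> ab /withinP[p [vp pu pa]]; apply/withinP; exists p; split=> //; lia.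
Qed.

Lemma within_trans a b u v z :
  within a v u -> within b u z -> within (a + b) v z.
Proof.
move=> /withinP[p [vp pu pa]] /withinP[q [uq qz qb]]; apply/withinP.
exists (p ++ q); rewrite cat_path vp pu uq last_cat pu qz size_cat; split=> //.
lia.
Qed.

Lemma within_sym r v u : within r v u -> within r u v.
Proof.
move=> /withinP[p [vp <- pr]]; apply/withinP; exists (rev (belast v p)).
rewrite rev_path size_rev size_belast; split=> //.
- by rewrite (eq_path (e' := @adj G)) // => ? ?; rewrite /= adj_sym.
- by case: p vp pr => //= z p _ _; rewrite rev_cons last_rcons.
Qed.

Lemma adj_within r u v z : adj v u -> within r u z -> within r.+1 v z.
Proof.
move=> vu /withinP[p [up pz pr]]; apply/withinP.
by exists (u :: p); rewrite /= vu up.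
Qed.

Lemma withinS r v z :
  within r.+1 v z -> v = z \/ exists2 u, adj v u & within r u z.
Proof.
move=> /withinP[[|u p] [/= + pz pr]]; first by left.
by move=> /andP[vu up]; right; exists u => //; apply/withinP; exists p.
Qed.

End Within.

(** Bundling graph, identifiers, inputs and coins allows nodes of different networks to be
    compared. *)
Record instance (X : Type) := Instance {
  i_graph :> sgraph;
  i_id : i_graph -> nat;
  i_in : i_graph -> X;
  i_coin : i_graph * nat -> bool;
  i_inj : injective i_id
}.

(* [k] rounds of communication cannot distinguish [v] from [v']. *)
Fixpoint sim (X : Type) (I I' : instance X) (k : nat) (v : I) (v' : I')
    : Prop :=
  match k with
  | 0 => [/\ #|I| = #|I'|, i_id v = i_id v', i_in v = i_in v'
           & forall i, i_coin (v, i) = i_coin (v', i)]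
  | k'.+1 => [/\ sim k' v v',
      forall u, adj v u -> exists2 u', adj v' u' & sim k' u u'
    & forall u', adj v' u' -> exists2 u, adj v u & sim k' u u']
  end.

Section Sim.
Variables (X : Type).
Implicit Types (I : instance X) (k a b : nat).

Lemma sim_sym I I' k (v : I) (v' : I') : sim k v v' -> sim k v' v.
Proof.
elim: k v v' => [|k IHk] v v' /=; first by case=> -> -> ->; split.
move=> [vv' h h']; split; first exact: IHk.
- by move=> u /h'[u' ? /IHk]; exists u'.
- by move=> u /h[u' ? /IHk]; exists u'.
Qed.

Lemma sim_leq I I' a b (v : I) (v' : I') : (a <= b)%N -> sim b v v' -> sim a v v'.
Proof.
move=> /subnK <-; elim: (b - a)%N => // k IHk; rewrite addSn => -[vv' _ _].
exact: IHk.
Qed.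

Lemma sim_within I I' a b (v : I) (v' : I') u : sim (a + b) v v' ->
  within b v u -> exists2 u', within b v' u' & sim a u u'.
Proof.
elim: b v v' => [|b IHb] v v'.
  by rewrite addn0 => vv' /within0 <-; exists v' => //; exact: within_refl.
move=> vv' /withinS[<-|[z vz zu]].
  by exists v'; [exact: within_refl|exact: sim_leq (leq_addr _ _) vv'].
move: vv'; rewrite addnS => -[_ /(_ _ vz)[z' v'z' zz'] _].
have [u' z'u' uu'] := IHb _ _ zz' zu.
by exists u' => //; exact: adj_within v'z' z'u'.
Qed.

Lemma sim_id I I' k (v : I) (v' : I') : sim k v v' -> i_id v = i_id v'.
Proof. by move/(sim_leq (leq0n k)) => []. Qed.

Lemma sim_card I I' k (v : I) (v' : I') : sim k v v' -> #|I| = #|I'|.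
Proof. by move/(sim_leq (leq0n k)) => []. Qed.

(** Identifiers are injective, so the match supplied by [sim_within] must be the node [u'] that
    carries the identifier of [u]. *)
Lemma sim_at I I' a b (v : I) (v' : I') u u' : sim (a + b) v v' ->
  within b v u -> i_id u = i_id u' -> within b v' u' /\ sim a u u'.
Proof.
move=> vv' vu uu'; have [z v'z uz] := sim_within vv' vu.
have -> : u' = z by apply: i_inj; rewrite -uu' (sim_id uz).
by [].
Qed.

Lemma sim_within_eq I I' a (v : I) (v' : I') u u' : sim a v v' ->
  i_id u = i_id u' -> within a v u = within a v' u'.
Proof.
move=> vv' uu'; apply/idP/idP => h.
  by case: (@sim_at _ _ 0 a _ _ u u' vv' h uu').
by case: (@sim_at _ _ 0 a _ _ u' u (sim_sym vv') h (esym uu')).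
Qed.

End Sim.

(** * Full-information algorithms *)

Inductive history (X : Type) :=
  | Initial of nat & nat & X & (nat -> bool)
  | Round of history X & (nat -> option (history X)).

Fixpoint history_size (X : Type) (h : history X) : nat :=
  match h with Initial n _ _ _ => n | Round h' _ => history_size h' end.

Definition gather (X Y : Type) (T : nat -> nat) (out : history X -> Y) :=
  @LocalAlg X Y (history X) (history X) T (@Initial X) (fun s _ => s)
    (@Round X) out.

Section Gather.
Variables (X Y : Type) (T : nat -> nat) (out : history X -> Y).

Definition gathered (I : instance X) k (v : I) : history X :=
  local_states (gather T out) (@i_id X I) (@i_in X I) (@i_coin X I) k v.

(** Inboxes are indexed by identifiers, which are injective; equal inboxes therefore match each
    neighbour with one of the same identifier and equal history. *)
Lemma gathered_sim (I I' : instance X) k (v : I) (v' : I') :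
  gathered k v = gathered k v' -> sim k v v'.
Proof.
rewrite /gathered; elim: k I I' v v' => [|k IHk] I I' v v' /=.
  by move=> [-> -> -> h]; split=> // i; rewrite -[RHS](congr1 (@^~ i) h).
move=> [/IHk vv' h]; split=> // u vu.
  have := congr1 (fun f => f (i_id u)) h; rewrite /inbox.
  case: pickP => [u1 /andP[_ /eqP/i_inj->]|/(_ u)]; last by rewrite vu eqxx.
  by case: pickP => //= u' /andP[v'u' _] [/IHk]; exists u'.
have := congr1 (fun f => f (i_id u)) (esym h); rewrite /inbox.
case: pickP => [u1 /andP[_ /eqP/i_inj->]|/(_ u)]; last by rewrite vu eqxx.
by case: pickP => //= u' /andP[v'u' _] [/esym/IHk]; exists u'.
Qed.

Lemma history_size_gathered (I : instance X) k (v : I) :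
  history_size (gathered k v) = #|I|.
Proof. by rewrite /gathered; elim: k v => /=. Qed.

End Gather.

(** After gathering, a node may output the value of [F] in any instance that yields its history; the
    hypothesis makes this choice immaterial. The default [y0] serves histories that no instance
    produces. *)
Lemma local_alg_of_sim (X Y : Type) (y0 : Y) (T : nat -> nat)
    (F : forall I : instance X, I -> Y) :
  (forall (I I' : instance X) (v : I) (v' : I'),
     sim (T #|I|) v v' -> F I v = F I' v') ->
  exists2 A : local_alg X Y, l_rounds A = T &
    forall (I : instance X) (v : I),
      local_output A (@i_id X I) (@i_in X I) (@i_coin X I) v = F I v.
Proof.
move=> FT.
pose g (I : instance X) (v : I) :=
  gathered T (fun=> y0) (T #|I|) v.
pose Q h (y : Y) := exists (I : instance X) (v : I), g I v = h /\ F I v = y.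
pose out h := if pselect (exists y, Q h y) is left e then projT1 (cid e) else y0.
exists (gather T out) => // I v.
rewrite [LHS]/(out (g I v)).
rewrite /out; case: pselect => [e|[]]; last by exists (F I v), I, v.
case: (cid e) => y /= [I' [v' [gv' <-]]]; apply: FT.
(* [T] is evaluated at the number of nodes, which every history records, so both histories come from
   the same number of rounds. *)
have cI : #|I'| = #|I|.
  by rewrite -(history_size_gathered T (fun=> y0) (T #|I'|) v') [gathered _ _ _ _]gv'
    history_size_gathered.
by move: gv'; rewrite /g -cI; exact: gathered_sim.
Qed.

(** * SLOCAL executions ordered by keys *)

Lemma ball_view_ext (X S : Type) (G : sgraph) (id : G -> nat) (x : G -> X)
    (mem mem' : G -> option S) r v :
  (forall u, within r v u -> mem u = mem' u) ->
  ball_view id x mem r v = ball_view id x mem' r v.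
Proof.
move=> e; congr View; apply: funext => j.
by case: pickP => //= u /andP[/e ->].
Qed.

(** The extra round is spent on edges: one between two nodes at distance [r] from [v] is known to
    its endpoints only after a round. *)
Lemma ball_view_sim (X S : Type) (I I' : instance X) (mem : I -> option S)
    (mem' : I' -> option S) r (v : I) (v' : I') :
  sim r.+1 v v' ->
  (forall u u', within r v u -> i_id u = i_id u' -> mem u = mem' u') ->
  ball_view (@i_id X I) (@i_in X I) mem r v =
  ball_view (@i_id X I') (@i_in X I') mem' r v'.
Proof.
move=> vv' e.
have edge (J J' : instance X) (y : J) (y' : J') (u z : J) (u' z' : J') :
    sim r.+1 y y' ->
    within r y u -> i_id u = i_id u' -> i_id z = i_id z' -> adj u z -> adj u' z'.
  move=> yy' yu uu' zz' uz.
  have [_ [_ /(_ _ uz)[t u't zt] _]] := @sim_at _ _ _ 1 r _ _ u u' yy' yu uu'.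
  by have -> : z' = t by apply: i_inj; rewrite -zz' (sim_id (k := 0) zt).
have edges (J J' : instance X) (y : J) (y' : J') i j : sim r.+1 y y' ->
    [exists u, exists z, [&& within r y u, within r y z, adj u z,
       i_id u == i & i_id z == j]] ->
    [exists u, exists z, [&& within r y' u, within r y' z, adj u z,
       i_id u == i & i_id z == j]].
  move=> yy' /existsP[u /existsP[z /and5P[yu yz uz /eqP<- /eqP<-]]].
  have [u' y'u' /sim_id uu'] := @sim_within _ _ _ 1 r _ _ u yy' yu.
  have [z' y'z' /sim_id zz'] := @sim_within _ _ _ 1 r _ _ z yy' yz.
  apply/existsP; exists u'; apply/existsP; exists z'.
  by rewrite y'u' y'z' uu' zz' !eqxx (edge _ _ _ _ _ _ _ _ yy' yu uu' zz' uz).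
congr View; apply: funext => i; last first.
  by apply: funext => j; apply/idP/idP; apply: edges => //; exact: sim_sym.
case: pickP => [u /andP[vu /eqP<-]|noI] /=.
  have [u' v'u' [_ uu' xx' _]] := @sim_within _ _ _ 0 r _ _ u (sim_leq (leqnSn r) vv') vu.
  case: pickP => [z /andP[_ /eqP zu]|/(_ u')]; last by rewrite v'u' uu' eqxx.
  have -> : z = u' by apply: i_inj; rewrite zu.
  by rewrite /= xx' (e u u').
case: pickP => //= u' /andP[v'u' /eqP iu'].
have [u vu /sim_id uu'] :=
  @sim_within _ _ _ 0 r _ _ u' (sim_sym (sim_leq (leqnSn r) vv')) v'u'.
by have := noI u; rewrite vu -uu' iu' eqxx.
Qed.

Section KeyedExecution.
Variables (X Y : Type) (A : slocal_alg X Y).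

Section OneGraph.
Variables (G : sgraph) (id : G -> nat) (x : G -> X) (w : G * nat -> bool).
Variable key : G -> nat.
Implicit Types (k : nat) (p : pred G) (u v : G).

(* What the SLOCAL algorithm stores and outputs at [v] when it processes the
   nodes of [p] in increasing order of their keys, by recursion on a bound [k]
   on the key of [v]. *)
Fixpoint keyed_run p k v : s_store A * Y :=
  s_step #|G| (id v) (fun i => w (v, i))
    (ball_view id x
       (fun u => if k is k'.+1 then
                   if p u && (key u < key v)%N then Some (keyed_run p k' u).1
                   else None
                 else None)
       (s_locality A #|G|) v).

(** Keys strictly decrease along the recursion, so every bound that is at least [key v] gives the
    same value. *)
Lemma keyed_runE p k v : (key v <= k)%N ->
  keyed_run p k v =
  s_step #|G| (id v) (fun i => w (v, i))
    (ball_view id x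
       (fun u => if p u && (key u < key v)%N then Some (keyed_run p k u).1
                 else None)
       (s_locality A #|G|) v).
Proof.
have stable : forall k1 k2 u, (key u <= k1)%N -> (key u <= k2)%N ->
    keyed_run p k1 u = keyed_run p k2 u.
  elim=> [|k1 IHk] [|k2] u //= uk1 uk2; congr s_step; apply: ball_view_ext => z _.
  - by case: ifP => // /andP[_]; lia.
  - by case: ifP => // /andP[_]; lia.
  - case: ifP => // /andP[_ zu]; congr (Some _.1); apply: IHk; lia.
case: k => [|k] vk /=; congr s_step; apply: ball_view_ext => z _.
  by case: ifP => // /andP[_]; lia.
case: ifP => // /andP[_ zu]; congr (Some _.1); by apply: (stable k k.+1); lia.
Qed.

Lemma slocal_run_keyed (order : seq G) k :
  sorted (fun u v => key u < key v)%N order -> (forall v, v \in order) ->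
  (forall v, key v <= k)%N ->
  forall v, slocal_run A id x w order v = Some (keyed_run predT k v).
Proof.
move=> so all_in keyk v.
have ktr : transitive (fun u v => key u < key v)%N by move=> ? ? ?; exact: ltn_trans.
(* Induction on the processed prefix: as the order is sorted, its nodes are exactly those with a
   smaller key than the next node. *)
suff run : forall s t, order = s ++ t -> forall u,
    slocal_run A id x w s u = if u \in s then Some (keyed_run predT k u) else None.
  by rewrite (run order [::]) ?cats0 // all_in.
elim/last_ind => [|s z IHs] t ost u //.
rewrite /slocal_run foldl_rcons -/(slocal_run A id x w s) /slocal_process.
rewrite mem_rcons inE; case: eqP => [->|_] /=; last first.
  by apply: (IHs (z :: t)); rewrite ost cat_rcons.
rewrite keyed_runE //; congr (Some (s_step _ _ _ _)).
apply: ball_view_ext => y _; rewrite (IHs (z :: t)) ?ost ?cat_rcons //=.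
have := so; rewrite ost cat_rcons sorted_pairwise // pairwise_cat allrel_consr.
rewrite pairwise_cons => /and3P[/andP[/allP sz _] _ /andP[/allP zt _]].
have := all_in y; rewrite ost cat_rcons mem_cat inE.
case ys: (y \in s) => /=; first by rewrite (sz _ ys).
by case/orP => [/eqP->|/zt zy]; rewrite ?ltnn // ltnNge ltnW.
Qed.

(** The recursion from [v] only visits ends of key-decreasing chains, and these all lie in [p]. *)
Lemma keyed_run_reachable p k v :
  (forall q, path (fun u z => within (s_locality A #|G|) u z &&
                              (key z < key u)%N) v q -> p (last v q)) ->
  keyed_run p k v = keyed_run predT k v.
Proof.
elim: k v => [|k IHk] v pv //=; congr s_step; apply: ball_view_ext => u vu.
case: ltnP => uv; rewrite ?andbF //= andbT.
have -> : p u by apply: (pv [:: u]); rewrite /= vu uv.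
by rewrite IHk // => q uq; apply: (pv (u :: q)); rewrite /= vu uv.
Qed.

End OneGraph.

Variables (key : forall I : instance X, I -> nat) (T L : nat -> nat).
Hypothesis key_sim : forall (I I' : instance X) (v : I) (v' : I'),
  sim (T #|I|) v v' -> key v = key v'.

Definition ball_run (I : instance X) (k : nat) (v : I) : s_store A * Y :=
  keyed_run (@i_id X I) (@i_in X I) (fun ui => i_coin (ui.1, ui.2.*2))
    (@key I) (within (L #|I|) v) k v.

(** A node of the ball is at distance at most [L], what it reads is at most [s_locality] further,
    and keys there take [T] more rounds; the maximum with 1 leaves a round for seeing edges. *)
Lemma ball_run_sim (I I' : instance X) k (v : I) (v' : I') :
  sim (maxn (T #|I|) 1 + s_locality A #|I| + L #|I|) v v' ->
  ball_run k v = ball_run k v'.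
Proof.
move=> vv'; have n' := sim_card vv'.
suff run u u' : within (L #|I|) v u -> i_id u = i_id u' ->
    keyed_run (@i_id X I) (@i_in X I) (fun ui => i_coin (ui.1, ui.2.*2))
      (@key I) (within (L #|I|) v) k u =
    keyed_run (@i_id X I') (@i_in X I') (fun ui => i_coin (ui.1, ui.2.*2))
      (@key I') (within (L #|I|) v') k u'.
  by rewrite /ball_run -n'; apply: run; [exact: within_refl|exact: sim_id vv'].
have inL z z' : i_id z = i_id z' -> within (L #|I|) v z = within (L #|I|) v' z'.
  by apply: sim_within_eq; apply: sim_leq vv'; rewrite leq_addl.
elim: k u u' => [|k IHk] u u' vu uu' /=;
  have [_ suu'] := sim_at vv' vu uu';
  have [_ _ _ coins] := sim_leq (leq0n _) suu'; rewrite -n' uu'.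
  rewrite (_ : (fun i => i_coin (u, i.*2)) = (fun i => i_coin (u', i.*2))); last first.
    by apply: funext => i; exact: coins.
  congr s_step; apply: ball_view_sim => //; apply: sim_leq suu'.
  by rewrite -add1n leq_add2r leq_maxr.
rewrite (_ : (fun i => i_coin (u, i.*2)) = (fun i => i_coin (u', i.*2))); last first.
  by apply: funext => i; exact: coins.
congr s_step; apply: ball_view_sim.
  by apply: sim_leq suu'; rewrite -add1n leq_add2r leq_maxr.
move=> z z' uz zz'.
have keyT t t' : sim (maxn (T #|I|) 1) t t' -> @key I t = @key I' t'.
  by move=> tt'; apply: key_sim; apply: sim_leq tt'; rewrite leq_maxl.
have -> : key z = key z' by apply: keyT; case: (sim_at suu' uz zz').
have -> : key u = key u' by apply: keyT; apply: sim_leq suu'; rewrite leq_addr.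
rewrite (inL _ _ zz'); case: ifP => // /andP[v'z' _].
by rewrite (IHk z z') // (inL _ _ zz').
Qed.

End KeyedExecution.

(** * Network decomposition *)

Section Clustering.
Variables (G : sgraph) (id : G -> nat) (r M : nat).
Variable bit : G -> nat -> nat -> bool.
Implicit Types (p d : nat) (u v y z : G).

(* The value is [M] when [v] is not within [(M - 1) * r] of [y]. *)
Definition hops y v := find (fun d => within (d * r) y v) (iota 0 M).

(* In phase [p] the ball of [v] has as radius, in steps of length [r], the
   number of leading ones of [bit v p]: [v] reaches the nodes at up to this
   distance, but only those strictly closer can join its cluster. *)
Definition reaches p v y := (hops y v < M)%N && all (bit v p) (iota 0 (hops y v)).

(** The default [y] is itself a candidate, at hop distance 0, as soon as [M] is positive. *)
Definition center p y := [arg max_(v > y | reaches p v y) id v].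

(** This is the first bit of the center that [reaches] does not read; if it is one, [y] lies
    strictly inside the ball. *)
Definition joins p y := bit (center p y) p (hops y (center p y)).

Definition color y := find (joins^~ y) (iota 0 M).

Lemma color_leqM y : (color y <= M)%N.
Proof. by rewrite -[leqRHS](size_iota 0) find_size. Qed.

Lemma hops_within y v : (hops y v < M)%N -> within (hops y v * r) y v.
Proof.
move=> h; have := @nth_find _ 0%N (fun d => within (d * r) y v) (iota 0 M).
by rewrite has_find size_iota nth_iota // => /(_ h).
Qed.

Lemma hops_leq d y v : (d < M)%N -> within (d * r) y v -> (hops y v <= d)%N.
Proof.
move=> dM yv; rewrite leqNgt; apply/negP => /(before_find 0%N).
by rewrite nth_iota // add0n yv.
Qed.

Lemma hops_refl y : (0 < M)%N -> hops y y = 0%N.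
Proof. by move=> M0; apply/eqP; rewrite -leqn0 hops_leq // within_refl. Qed.

Lemma joins_color y : (color y < M)%N -> joins (color y) y.
Proof.
move=> h; have := @nth_find _ 0%N (joins^~ y) (iota 0 M).
by rewrite has_find size_iota nth_iota // => /(_ h).
Qed.

Section Positive.
Hypothesis M_gt0 : (0 < M)%N.

Lemma centerP p y :
  reaches p (center p y) y /\ forall v, reaches p v y -> (id v <= id (center p y))%N.
Proof.
have yy : reaches p y y by rewrite /reaches hops_refl // M_gt0.
by rewrite /center; case: arg_maxnP.
Qed.

Lemma hops_center p y : (hops y (center p y) < M)%N.
Proof. by case: (centerP p y) => /andP[]. Qed.

Lemma within_center p y : within (M * r) y (center p y).
Proof.
apply: within_leq (hops_within (hops_center p y)).
by rewrite leq_mul2r ltnW ?orbT // hops_center.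
Qed.

Hypothesis id_inj : injective id.
Hypothesis bit0 : forall v p, (p < M)%N -> ~~ all (bit v p) (iota 0 M).

(** Since [y] lies strictly inside the ball of its center, there is room for one more step. By
    [bit0] the radius stays below [M], so [hops] is not truncated at [z]. *)
Lemma reaches_next p y z : (p < M)%N -> within r y z -> joins p y ->
  reaches p (center p y) z.
Proof.
move=> pM yz jy; have [/andP[hM all1] _] := centerP p y; rewrite /reaches.
set v := center p y in hM all1 jy *; set d := hops y v in hM all1 *.
have all1S : all (bit v p) (iota 0 d.+1).
  by rewrite -addn1 iotaD all_cat all1 /= andbT add0n.
have dM : (d.+1 < M)%N.
  rewrite ltn_neqAle hM andbT; apply/negP => /eqP dM.
  by have := bit0 v pM; rewrite -dM all1S.
have zv : (hops z v <= d.+1)%N.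
  apply: hops_leq => //; rewrite mulSn; apply: within_trans (within_sym yz) _.
  exact: hops_within.
rewrite (leq_ltn_trans zv dM); apply/allP => q; rewrite mem_iota => /andP[_ qz].
by apply: (allP all1S); rewrite mem_iota /=; lia.
Qed.

(** Each center also reaches the other node, so maximality bounds each identifier by the other. *)
Lemma center_eq p y z : (p < M)%N -> within r y z -> joins p y -> joins p z ->
  center p y = center p z.
Proof.
move=> pM yz jy jz; apply: id_inj; apply/eqP; rewrite eqn_leq.
have [_ -> /=] := centerP p z; last exact: reaches_next yz jy.
by have [_ ->] := centerP p y; last exact: reaches_next (within_sym yz) jz.
Qed.

Hypothesis color_lt : forall y, (color y < M)%N.

(* A color-decreasing chain with steps of length at most [r] stays in one
   cluster while its color is constant, since adjacent clusters of one color
   are equal; hence it advances by a bounded distance for each color. *)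
Lemma decreasing_chain_within v q :
  path (fun u z => within r u z && (color z <= color u)%N) v q ->
  within (M * (M * r + r + M * r)) v (last v q).
Proof.
move=> vq; set K := (M * r + r + M * r)%N.
pose c u := center (color u) u.
have cw u : within (M * r) u (c u) by exact: within_center.
(* The distance is measured to the center of the last node. This center is fixed while the color is
   constant; when the color drops, it moves by at most [K]: back to the node, one step, and on to
   the new center. *)
have [inv le] : within ((color v - color (last v q)) * K + M * r) v (c (last v q))
    /\ (color (last v q) <= color v)%N.
  elim/last_ind: q vq => [_|q z IHq] /=; first by rewrite subnn mul0n add0n.
  rewrite rcons_path last_rcons => /andP[/IHq[IH le] /andP[uz cz]].
  set u := last v q in IH le uz cz *; split; last exact: leq_trans cz le.
  move: cz; rewrite leq_eqVlt => /orP[/eqP cz|cz].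
    rewrite /c cz -(center_eq _ uz) // -/(c u) //; last first.
      by rewrite -cz joins_color.
    exact: joins_color.
  have := within_trans (within_trans IH (within_sym (cw u)))
    (within_trans uz (cw z)).
  apply: within_leq.
  have -> : (color v - color z = (color v - color u) + (color u - color z))%N by lia.
  rewrite mulnDl; have : (1 * K <= (color u - color z) * K)%N.
    by rewrite leq_mul2r subn_gt0 cz orbT.
  by rewrite mul1n /K; lia.
apply: within_leq (within_trans inv (within_sym (cw _))).
(* The color drops by at most [M - 1] in total; the remaining [K] pays for the ways between node and
   center at both ends. *)
have hM : (color v - color (last v q) <= M.-1)%N by have := color_lt v; lia.
have : ((color v - color (last v q)) * K <= M.-1 * K)%N by rewrite leq_mul2r hM orbT.
have : (M * K = M.-1 * K + K)%N by rewrite -mulSnr prednK.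
by rewrite {2 4 6}/K; lia.
Qed.

End Positive.
End Clustering.

(* The odd coins serve the decomposition, the even ones the SLOCAL algorithm. *)
Definition phase_bits (V : Type) M (w : V * nat -> bool) (v : V) (p q : nat) : bool :=
  [&& (p < M)%N, (q < M)%N & w (v, (pickle (p, q)).*2.+1)].

Section ColorSim.
Variables (X : Type) (r M : nat).
Implicit Types (I : instance X) (p : nat).

Definition inst_color I : I -> nat := color (@i_id X I) r M (phase_bits M (@i_coin X I)).

(** Every node that reaches [y] is within [M * r]. Each center has a matching candidate on the other
    side, so the identifiers of the two centers bound each other. *)
Lemma color_sim I I' (y : I) (y' : I') : (0 < M)%N -> sim (M * r) y y' ->
  inst_color y = inst_color y'.
Proof.
move=> M0 yy'.
have bitE (J J' : instance X) (u : J) (u' : J') p q : sim 0 u u' ->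
    phase_bits M (@i_coin X J) u p q = phase_bits M (@i_coin X J') u' p q.
  by case=> _ _ _ c; rewrite /phase_bits c.
have hopsE (J J' : instance X) (z u : J) (z' u' : J') : sim (M * r) z z' ->
    i_id u = i_id u' -> hops r M z u = hops r M z' u'.
  move=> zz' uu'; apply: eq_in_find => d; rewrite mem_iota => /andP[_ dM].
  by apply: sim_within_eq uu'; apply: sim_leq zz'; rewrite leq_mul2r ltnW ?orbT.
have near (J J' : instance X) (z u : J) (z' u' : J') : sim (M * r) z z' ->
    (hops r M z u < M)%N -> i_id u = i_id u' -> sim 0 u u'.
  move=> zz' zu uu'; have [] // := @sim_at _ _ _ 0 (M * r) _ _ u u' zz' _ uu'.
  by apply: within_leq (hops_within zu); rewrite leq_mul2r ltnW ?orbT.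
have idle (J J' : instance X) (z : J) (z' : J') p : sim (M * r) z z' ->
    (i_id (center (@i_id X J) r M (phase_bits M (@i_coin X J)) p z) <=
     i_id (center (@i_id X J') r M (phase_bits M (@i_coin X J')) p z'))%N.
  move=> zz'; set u := center _ _ _ _ _ z.
  have [zu _] := @centerP J (@i_id X J) r M (phase_bits M (@i_coin X J)) M0 p z.
  case/andP: (zu); rewrite -/u => hM all1.
  have [|u' z'u' uu'] := @sim_within _ _ _ 0 (M * r) _ _ u zz'.
    by apply: within_leq (hops_within hM); rewrite leq_mul2r ltnW ?orbT.
  rewrite (sim_id (k := 0) uu').
  have [_ ->//] := @centerP J' (@i_id X J') r M (phase_bits M (@i_coin X J')) M0 p z'.
  rewrite /reaches -(hopsE _ _ _ _ _ _ zz' (sim_id (k := 0) uu')) hM /=.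
  by apply/allP => q /(allP all1); rewrite (bitE _ _ _ _ _ _ uu').
apply: eq_find => p; rewrite /joins.
set u := center _ _ _ _ _ y; set u' := center _ _ _ _ _ y'.
have uu' : i_id u = i_id u'.
  by apply/eqP; rewrite eqn_leq !idle //; exact: sim_sym.
rewrite (hopsE _ _ _ _ _ _ yy' uu'); apply: bitE; apply: near yy' _ uu'.
exact: hops_center.
Qed.

End ColorSim.

(** * Failure probability of the decomposition *)

(** The involution [f i] flips condition [i] and preserves the earlier ones; it pairs the elements
    satisfying the earlier conditions, so each new condition halves their number. *)
Lemma card_all_toggled (T : finType) M (b : nat -> pred T) (f : nat -> T -> T) :
  (forall i, (i < M)%N -> involutive (f i)) ->
  (forall i t, (i < M)%N -> b i (f i t) = ~~ b i t) ->
  (forall i j t, (i < j)%N -> (j < M)%N -> b i (f j t) = b i t) ->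
  (#|[set t | all (b^~ t) (iota 0 M)]| * 2 ^ M = #|T|)%N.
Proof.
elim: M => [|M IHM] invo togg pres.
  by rewrite muln1 -cardsT; congr #|pred_of_set _|; apply/setP => t; rewrite !inE.
rewrite -IHM.
- set A := [set t | _]; set A' := [set t | _]; rewrite expnS mulnA; congr (_ * _)%N.
  have AE t : (t \in A) = (t \in A') && b M t.
    by rewrite !inE -addn1 iotaD all_cat /= andbT add0n.
  have A'f t : (f M t \in A') = (t \in A').
    rewrite !inE; apply: eq_in_all => i; rewrite mem_iota => /andP[_ iM].
    by rewrite pres.
  have -> : #|A'| = (#|A| + #|A' :\: A|)%N.
    rewrite -(cardsID A A'); congr (#|pred_of_set _| + _)%N; apply/setP => t.
    by rewrite finset.in_setI AE; case: (t \in A').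
  rewrite muln2 -addnn; congr (_ + _)%N.
  rewrite -(card_imset _ (inv_inj (invo M (ltnSn M)))); congr #|pred_of_set _|.
  apply/setP => t; rewrite finset.in_setD AE; apply/imsetP/andP.
    by case=> z; rewrite AE => /andP[zA' bz] ->; rewrite A'f togg // bz zA'.
  case; rewrite negb_and => /[swap] tA'; rewrite tA' /= => bt.
  by exists (f M t); rewrite ?AE ?A'f ?tA' ?togg // invo.
- by move=> i iM; apply: invo; apply: leq_trans iM _.
- by move=> i t iM; apply: togg; apply: leq_trans iM _.
- by move=> i j t ij jM; apply: pres => //; apply: leq_trans jM _.
Qed.

Lemma leq_card_bigcup (I T : finType) (A : I -> {set T}) :
  (#|\bigcup_i A i| <= \sum_i #|A i|)%N.
Proof.
elim/big_rec2: _ => [|i k B _ IH]; first by rewrite cards0.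
by apply: leq_trans (leq_card_setU _ _) _; rewrite leq_add2l.
Qed.

Section PhaseTable.
Variables (V : finType) (M : nat).

(** The decomposition reads only these finitely many coins, which turns its failure probability into
    a ratio of cardinalities. *)
Definition phase_table := {ffun V * ('I_M * 'I_M) -> bool}.
Implicit Types (rho : phase_table) (p q : nat) (u v : V).

Definition table_bits rho v p q : bool :=
  match insub p, insub q with
  | Some p', Some q' => rho (v, (p', q'))
  | _, _ => false
  end.

Definition table_flip v p q rho : phase_table :=
  [ffun k : V * ('I_M * 'I_M) =>
     [&& k.1 == v, k.2.1 == p :> nat & k.2.2 == q :> nat] (+) rho k].

Lemma table_flipK v p q : involutive (table_flip v p q).
Proof. by move=> rho; apply/ffunP => k; rewrite !ffunE addKb. Qed.

Lemma table_bits_flip rho v p q u p' q' : (p' < M)%N -> (q' < M)%N ->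
  table_bits (table_flip v p q rho) u p' q' =
  [&& u == v, p' == p & q' == q] (+) table_bits rho u p' q'.
Proof. by move=> pM qM; rewrite /table_bits !insubT ffunE. Qed.

Lemma card_all_bits v p : (p < M)%N ->
  (#|[set rho : phase_table | all (table_bits rho v p) (iota 0 M)]| * 2 ^ M =
   #|{: phase_table}|)%N.
Proof.
move=> pM; apply: (@card_all_toggled _ M (fun q rho => table_bits rho v p q)
  (fun q => table_flip v p q)) => [q _|q rho qM|q q' rho qq' qM].
- exact: table_flipK.
- by rewrite table_bits_flip // !eqxx.
- by rewrite table_bits_flip ?(ltn_trans qq') // (ltn_eqF qq') !andbF.
Qed.

End PhaseTable.

Section PhaseCount.
Variables (G : sgraph) (id : G -> nat) (r M : nat).
Hypothesis M_gt0 : (0 < M)%N.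
Implicit Types (rho : phase_table G M) (p : nat) (y v : G).

(** The disjuncts negate [bit0] and [color_lt], the assumptions under which decreasing chains are
    bounded. *)
Definition fails_to_cluster rho :=
  [exists v, exists p : 'I_M, all (table_bits rho v p) (iota 0 M)] ||
  [exists y, color id r M (table_bits rho) y == M].

(* Whether a node reaches [y] is independent of the next bit, which decides
   whether [y] joins. *)
Definition center_flip y p rho :=
  let c := center id r M (table_bits rho) p y in
  table_flip c p (hops r M y c) rho.

(** Reaching [y] reads the bits of [v] at positions below [hops r M y v]; if [v] is the center, the
    flipped bit sits exactly at that position. *)
Lemma reaches_flip y p rho p' v : (p' < M)%N ->
  reaches r M (table_bits (center_flip y p rho)) p' v y =
  reaches r M (table_bits rho) p' v y.
Proof.
move=> pM; rewrite /reaches; case: ltnP => //= hM; apply: eq_in_all => q.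
rewrite mem_iota => /andP[_ qh]; rewrite table_bits_flip //; last first.
  exact: ltn_trans hM.
case: eqP => //= <-; case: eqP => //= _.
by rewrite (ltn_eqF qh).
Qed.

Lemma center_flipE y p rho p' : (p' < M)%N ->
  center id r M (table_bits (center_flip y p rho)) p' y =
  center id r M (table_bits rho) p' y.
Proof.
move=> pM; rewrite /center /arg_max /extremum; congr odflt.
apply: eq_pick => z /=; rewrite reaches_flip //; congr andb.
by apply: eq_forallb => v; rewrite reaches_flip.
Qed.

(** Flipping the next bit of the center toggles whether [y] joins in that phase and leaves the
    earlier phases alone, so each phase halves the tables in which [y] has not joined. *)
Lemma card_never_joins y :
  (#|[set rho : phase_table G M | color id r M (table_bits rho) y == M]| * 2 ^ M =
   #|{: phase_table G M}|)%N.
Proof.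
rewrite -(@card_all_toggled _ M
  (fun p (rho : phase_table G M) => ~~ joins id r M (table_bits rho) p y) (center_flip y)).
- congr (#|pred_of_set _| * _)%N; apply/setP => rho; rewrite !inE.
  rewrite [all _ _]all_predC has_find size_iota -leqNgt.
  by rewrite eqn_leq color_leqM.
- move=> p pM rho; rewrite {1}/center_flip center_flipE //; exact: table_flipK.
- move=> p rho pM; rewrite /joins center_flipE //.
  by rewrite table_bits_flip ?hops_center // !eqxx.
- move=> p p' rho pp' p'M; have pM := ltn_trans pp' p'M.
  rewrite /joins center_flipE // table_bits_flip ?hops_center //.
  by rewrite (ltn_eqF pp') andbF.
Qed.

(** Union bound: [#|G| * M] rows may be all ones and [#|G|] nodes may never join, each in a
    [2 ^ - M] share of the tables. *)
Lemma card_fails_to_cluster :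
  (#|[set rho | fails_to_cluster rho]| * 2 ^ M <=
   #|G| * M.+1 * #|{: phase_table G M}|)%N.
Proof.
pose A v (p : 'I_M) := [set rho : phase_table G M | all (table_bits rho v p) (iota 0 M)].
pose B y := [set rho : phase_table G M | color id r M (table_bits rho) y == M].
have sub : [set rho | fails_to_cluster rho] \subset
    (\bigcup_v \bigcup_p A v p) :|: (\bigcup_y B y).
  apply/fintype.subsetP => rho; rewrite inE.
  move=> /orP[/existsP[v /existsP[p h]]|/existsP[y h]].
    by rewrite inE; apply/orP; left; apply/finset.bigcupP; exists v => //;
      apply/finset.bigcupP; exists p => //; rewrite inE.
  by rewrite inE; apply/orP; right; apply/finset.bigcupP; exists y => //; rewrite inE.
apply: (@leq_trans ((\sum_v \sum_(p < M) #|A v p| + \sum_y #|B y|) * 2 ^ M)).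
  rewrite leq_mul2r; apply/orP; right; apply: leq_trans (subset_leq_card sub) _.
  apply: leq_trans (leq_card_setU _ _) _; apply: leq_add.
    apply: leq_trans (leq_card_bigcup _) _.
    by apply: leq_sum => v _; exact: leq_card_bigcup.
  exact: leq_card_bigcup.
rewrite mulnDl !big_distrl /=.
under eq_bigr => v _.
  rewrite big_distrl /=; under eq_bigr => p _ do rewrite card_all_bits //.
  rewrite sum_nat_const card_ord; over.
under [X in (_ + X)%N]eq_bigr => y _ do rewrite card_never_joins.
rewrite !sum_nat_const mulnA -mulnDl; apply: leq_mul => //.
by rewrite mulnS addnC.
Qed.

End PhaseCount.

(** * Choice of the number of phases *)

Definition phases C n := (2 * (C.+3 * (trunc_log 2 n).+1))%N.

Lemma phases_gt0 C n : (0 < phases C n)%N. Proof. by rewrite !muln_gt0. Qed.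

(** One half of the exponent pays for [n ^ C.+1], the other for the number of phases plus one. *)
Lemma leq_exp_phases C n : (0 < n)%N ->
  (n * (phases C n).+1 * n ^ C <= 2 ^ phases C n)%N.
Proof.
move=> n0; rewrite /phases; set l := (trunc_log 2 n).+1; set a := (C.+3 * l)%N.
set M := (2 * a)%N.
have nl : (n <= 2 ^ l)%N by rewrite ltnW // trunc_log_ltn.
(* The inequality [2 * a + 1 <= 2 ^ a] holds from [a = 3] on, which [C.+3] guarantees. *)
have Ma : (M.+1 <= 2 ^ a)%N.
  have : (3 <= a)%N by rewrite /a mulSn mulSn mulSn; lia.
  rewrite /M; elim: (a) => // k IHk; rewrite leq_eqVlt => /orP[/eqP <- //|].
  by rewrite ltnS => k3; have := IHk k3; rewrite expnS; lia.
have na : (n ^ C.+1 <= 2 ^ a)%N.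
  apply: (@leq_trans ((2 ^ l) ^ C.+1)); first by rewrite leq_exp2r.
  by rewrite -expnM leq_exp2l // mulnC leq_mul2r; apply/orP; right; lia.
have -> : (2 ^ M = 2 ^ a * 2 ^ a)%N by rewrite -expnD addnn -mul2n.
rewrite mulnAC -expnS; exact: leq_mul.
Qed.

(** * Polylogarithmic functions *)

Section PolyLog.
Variable R : realType.
Implicit Types (t : nat -> nat).

Lemma polylogP t : polylog R t <->
  exists k N : nat, forall n, (N <= n)%N -> (t n)%:R <= (ln n%:R : R) ^+ k.
Proof.
split; first by move=> [k [N _ h]]; exists k, N => n /h.
by move=> [k [N h]]; exists k, N.
Qed.

Lemma ln_nat_ge (a : R) : exists N : nat, forall n, (N <= n)%N -> a <= ln n%:R.
Proof.
exists (Num.truncn (expR a)).+1 => n Nn.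
have an : expR a <= n%:R.
  by apply: ltW; apply: lt_le_trans (truncnS_gt _) _; rewrite ler_nat.
rewrite -[leLHS]expRK ler_ln ?posrE ?expR_gt0 //.
exact: lt_le_trans (expR_gt0 a) an.
Qed.

Lemma polylog_cst m : polylog R (fun=> m).
Proof. by apply/polylogP; have [N h] := ln_nat_ge m%:R; exists 1%N, N. Qed.

Lemma polylog_trunc_log : polylog R (trunc_log 2).
Proof.
apply/polylogP; have ln2 : 0 < ln 2 :> R by rewrite ln_gt0 // ltr1n.
(* A second power of the logarithm absorbs the factor [1 / ln 2] from the change of base. *)
have [N h] := ln_nat_ge (ln 2)^-1; exists 2%N, N.+1 => n Nn.
have n0 : (0 < n)%N by lia.
have /h lnn : (N <= n)%N by lia.
have l0 : 0 <= (ln n%:R : R) by rewrite ln_ge0 // ler1n.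
rewrite expr2; apply: (@le_trans _ _ (ln n%:R / ln 2)); last by rewrite ler_wpM2l.
rewrite ler_pdivlMr // mulr_natl -lnXn // -natrX ler_ln ?posrE ?ltr0n ?expn_gt0 //.
by rewrite ler_nat; case/andP: (trunc_log_bounds (isT : (1 < 2)%N) n0).
Qed.

Lemma polylogD t1 t2 : polylog R t1 -> polylog R t2 ->
  polylog R (fun n => t1 n + t2 n)%N.
Proof.
move=> /polylogP[k1 [N1 h1]] /polylogP[k2 [N2 h2]]; apply/polylogP.
(* Once [ln n] is at least 2, one extra power absorbs the doubling. *)
have [N h] := ln_nat_ge 2; exists (k1 + k2).+1, (N1 + N2 + N)%N => n Nn.
have /h1 ? : (N1 <= n)%N by lia.
have /h2 ? : (N2 <= n)%N by lia.
have /h ln2 : (N <= n)%N by lia.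
have ln1 : 1 <= (ln n%:R : R) by apply: le_trans ln2; rewrite ler1n.
rewrite natrD; apply: (@le_trans _ _ (2 * ln n%:R ^+ (k1 + k2))).
  rewrite mulr2n mulrDl !mul1r; apply: lerD.
    apply: (@le_trans _ _ (ln n%:R ^+ k1)) => //.
    by apply: ler_weXn2l => //; rewrite leq_addr.
  apply: (@le_trans _ _ (ln n%:R ^+ k2)) => //.
    by apply: ler_weXn2l => //; rewrite leq_addl.
by rewrite exprS ler_wpM2r // exprn_ge0 // (le_trans _ ln1).
Qed.

Lemma polylogM t1 t2 : polylog R t1 -> polylog R t2 ->
  polylog R (fun n => t1 n * t2 n)%N.
Proof.
move=> /polylogP[k1 [N1 h1]] /polylogP[k2 [N2 h2]]; apply/polylogP.
exists (k1 + k2)%N, (N1 + N2)%N => n Nn.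
have /h1 ? : (N1 <= n)%N by lia.
have /h2 ? : (N2 <= n)%N by lia.
by rewrite natrM exprD; apply: ler_pM.
Qed.

End PolyLog.

(** * Conditioning on finitely many coins *)

Local Open Scope classical_set_scope.

Lemma prob_le_weaken (R : realType) (I : eqType) (F : set (I -> bool)) (e e' : R) :
  e <= e' -> prob_le F e -> prob_le F e'.
Proof.
move=> ee' Fe d Om P coin fc; have [B [mB FB] PB] := Fe d Om P coin fc.
by exists B => //; apply: le_trans PB _; rewrite lee_fin.
Qed.

Lemma measure_bigcup_fin_le d (T : measurableType d) (R : realType)
    (mu : {measure set T -> \bar R}) (I : finType) (A : I -> set T) :
  (forall i, measurable (A i)) ->
  (mu (\bigcup_i A i) <= \sum_i mu (A i))%E.
Proof.
move=> mA.
have -> : \bigcup_i A i = \big[setU/set0]_(i <- index_enum I) A i.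
  rewrite -bigcup_seq; apply/seteqP; split=> o [i _ Ai]; exists i => //=.
  exact: mem_index_enum.
elim: (index_enum I) => [|i s IHs]; first by rewrite !big_nil measure0.
rewrite !big_cons; apply: le_trans (leeD2l _ IHs).
apply: measureU2 => //; exact: bigsetU_measurable.
Qed.

Section Conditioning.
Variables (R : realType) (I I' : eqType) (J : finType).
Variables (f : I' -> I) (g : J -> I).
Hypotheses (f_inj : injective f) (g_inj : injective g).
Hypothesis fg_disj : forall i j, f i <> g j.

Section OneTable.
Variables (d : measure_display) (Om : measurableType d).
Variables (P : probability Om R) (coin : I -> Om -> bool).
Hypothesis coinP : fair_coins P coin.
Variable rho : {ffun J -> bool}.

Definition table_event := [set o | forall j, coin (g j) o = rho j].

Lemma measurable_table_event : measurable table_event.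
Proof.
have -> : table_event = \bigcap_(j in setT) (coin (g j) @^-1` [set rho j]).
  by apply/seteqP; split=> o h j; [move=> _|]; exact: h.
apply: fin_bigcap_measurable => // j _; rewrite -[X in measurable X]setTI.
exact: coinP.1.
Qed.

Lemma prob_table_event_and (D : seq I') (s : I' -> bool) : uniq D ->
  P ([set o | forall i, i \in D -> coin (f i) o = s i] `&` table_event) =
  (2^-1 ^+ (size D + #|J|))%:E.
Proof.
move=> uD; pose D' := map f D ++ map g (enum J).
(* The combined pattern on the disjoint images of [f] and [g], given by description since [f] comes
   without an inverse. *)
pose s' i := `[< (exists j, g j = i /\ rho j) \/ (exists k, f k = i /\ s k) >].
have s'g j : s' (g j) = rho j.
  apply/asboolP/idP => [[[k [/g_inj->]]|[k [/fg_disj]]]|] //.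
  by left; exists j.
have s'f k : s' (f k) = s k.
  apply/asboolP/idP => [[[j [/esym/fg_disj]]|[j [/f_inj->]]]|] //.
  by right; exists k.
have uD' : uniq D'.
  rewrite cat_uniq (map_inj_uniq f_inj) uD (map_inj_uniq g_inj) enum_uniq andbT /=.
  by apply/hasPn => _ /mapP[j _ ->]; apply/mapP => -[k _ /esym/fg_disj].
have sD' : size D' = (size D + #|J|)%N.
  by rewrite size_cat (size_map f) (size_map g) -cardE.
rewrite -sD' -(coinP.2 D' s' uD').
congr (P _); apply/seteqP; split=> o.
  move=> [h1 h2] i; rewrite mem_cat => /orP[] /mapP[k kD ->].
    by rewrite s'f; exact: h1.
  by rewrite s'g; exact: h2.
move=> h; split=> [k kD|j].
  by rewrite -s'f; apply: h; rewrite mem_cat map_f.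
by rewrite -s'g; apply: h; rewrite mem_cat map_f ?orbT // mem_enum.
Qed.

Lemma prob_table_event : P table_event = (2^-1 ^+ #|J|)%:E.
Proof.
rewrite -[#|J|](add0n) -(@prob_table_event_and [::] (fun=> true)) //.
by congr (P _); apply/seteqP; split=> o // [].
Qed.

(* [prob_le F e] is applied to [P] conditioned on the table event, under which
   the coins in the image of [f] are still fair. *)
Lemma prob_le_conditioned (F : set (I' -> bool)) (e : R) : prob_le F e ->
  exists B : set Om, [/\ measurable B,
    table_event `&` [set o | F (fun i => coin (f i) o)] `<=` B &
    (P B <= (e * 2^-1 ^+ #|J|)%:E)%E].
Proof.
move=> Fe; have mE := measurable_table_event.
pose h : R := 2^-1 ^+ #|J|.
have h0 : 0 < h by rewrite exprn_gt0 // invr_gt0.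
have evid : mrestr P mE [set: Om] = h%:E.
  by rewrite /mrestr setTI prob_table_event.
(* The degenerate branch of [mnormalize] is excluded, as the total mass [h] is positive and
   finite. *)
have QE U : mnormalize (mrestr P mE) P U = (P (U `&` table_event) * h^-1%:E)%E.
  transitivity (if (mrestr P mE [set: Om] == 0%E) || (mrestr P mE [set: Om] == +oo%E)
    then P U else (mrestr P mE U * (fine (mrestr P mE [set: Om]))^-1%:E)%E).
    by rewrite /mnormalize; case: ifP.
  by rewrite evid eqe gt_eqF.
have fc : fair_coins (mnormalize (mrestr P mE) P) (fun i => coin (f i)).
  split=> [i|D s uD]; first exact: coinP.1.
  by rewrite [LHS]QE prob_table_event_and // -EFinM exprD mulfK //.
have [B [mB FB] QB] := Fe _ _ _ _ fc.
exists (B `&` table_event); split.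
- exact: measurableI.
- by move=> o [Eo Fo]; split=> //; exact: FB.
- have := eq_ind _ (fun x => (x <= e%:E)%E) QB _ (QE B).
  have : (0 <= P (B `&` table_event))%E by [].
  have : (P (B `&` table_event) < +oo)%E.
    by apply: le_lt_trans (probability_le1 P _) _; [exact: measurableI|exact: ltry].
  case: (P (B `&` _)) => // p _ _; rewrite -EFinM !lee_fin ler_pdivrMr //.
Qed.

End OneTable.

(** Total probability over the equally likely tables: a bad one contributes its full mass, a good
    one at most the fraction [e] of it. Each slice is covered by its own measurable event, as [F]
    need not be measurable. *)
Lemma prob_le_split (bad : pred {ffun J -> bool})
    (F : set (I -> bool)) (F' : {ffun J -> bool} -> set (I' -> bool)) (e : R) :
  0 <= e ->
  (forall rho, ~~ bad rho -> prob_le (F' rho) e) ->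
  (forall w, F w -> let rho := [ffun j => w (g j)] in
     bad rho \/ F' rho (fun i => w (f i))) ->
  prob_le F (e + #|bad|%:R / #|{: {ffun J -> bool}}|%:R).
Proof.
move=> e0 F'e FF' d Om P coin fc.
pose h : R := 2^-1 ^+ #|J|.
have h0 : 0 <= h by rewrite exprn_ge0 // invr_ge0.
have cover rho : exists B : set Om, [/\ measurable B,
    table_event coin rho `&` [set o | F (coin^~ o)] `<=` B &
    (P B <= ((if bad rho then 1 else e) * h)%:E)%E].
  case: (boolP (bad rho)) => [_|nbad].
    exists (table_event coin rho); split.
    - exact: measurable_table_event fc rho.
    - by move=> o [].
    - by rewrite (prob_table_event fc rho) mul1r.
  have [B [mB FB PB]] := prob_le_conditioned fc rho (F'e _ nbad).
  exists B; split=> // o [Eo Fo]; apply: FB; split=> //=.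
  have rhoE : [ffun j => coin (g j) o] = rho by apply/ffunP => j; rewrite ffunE.
  by have := FF' _ Fo; rewrite /= rhoE (negbTE nbad) => -[].
have [B hB] := choice cover.
exists (\bigcup_rho B rho).
  split; first by apply: fin_bigcup_measurable => // rho _; case: (hB rho).
  move=> o Fo; exists [ffun j => coin (g j) o] => //.
  by have [_ + _] := hB [ffun j => coin (g j) o]; apply; split=> // j; rewrite ffunE.
apply: le_trans (measure_bigcup_fin_le _ _) _; first by move=> rho; case: (hB rho).
apply: (@le_trans _ _ (\sum_rho ((if bad rho then 1 else e) * h)%:E)%E).
  by apply: lee_sum => rho _; case: (hB rho).
rewrite sumEFin lee_fin -big_distrl /=.
have cardT : #|{: {ffun J -> bool}}|%:R * h = 1.
  by rewrite card_ffun card_bool natrX /h exprVn mulfV // gt_eqF // exprn_gt0.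
have -> : #|{: {ffun J -> bool}}|%:R = h^-1 :> R.
  by apply: (mulIf (_ : h != 0)); rewrite ?cardT ?mulVf ?gt_eqF // exprn_gt0 // invr_gt0.
rewrite invrK (bigID bad) /= mulrDl addrC; apply: lerD; last first.
  rewrite (eq_bigr (fun=> 1)); last by move=> rho ->.
  by rewrite sumr_const.
rewrite (eq_bigr (fun=> e)); last by move=> rho /negbTE ->.
rewrite sumr_const -mulr_natr -mulrA ler_piMr // -[leRHS]cardT ler_wpM2r //.
by rewrite ler_nat max_card.
Qed.

End Conditioning.

(** * Simulation *)

Definition table_coin (V : finType) M (j : V * ('I_M * 'I_M)) : V * nat :=
  (j.1, (pickle (j.2.1 : nat, j.2.2 : nat)).*2.+1).

Lemma table_coin_inj (V : finType) M : injective (@table_coin V M).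
Proof.
move=> [u [p q]] [v [p' q']] [-> /(congr1 half)].
rewrite /= !doubleK => /(pcan_inj pickleK)[pp' qq'].
by congr (_, (_, _)); exact: val_inj.
Qed.

Lemma phase_bits_table (V : finType) M (w : V * nat -> bool) :
  phase_bits M w = table_bits [ffun j => w (table_coin j)] (M := M).
Proof.
apply: funext => v; apply: funext => p; apply: funext => q.
rewrite /phase_bits /table_bits; case: insubP => [p' -> p'p|/negbTE-> //].
by case: insubP => [q' -> q'q|/negbTE-> //]; rewrite ffunE /table_coin /= p'p q'q.
Qed.

Section Simulation.
Variables (X Y : Type) (A : slocal_alg X Y) (b C : nat).

Definition id_bound n := (2 ^ (b * (trunc_log 2 n).+1))%N.

(** The lexicographic order on pairs (color, identifier), encoded in base [id_bound]. *)
Definition cluster_key (G : sgraph) (id : G -> nat) (bit : G -> nat -> nat -> bool)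
    (v : G) : nat :=
  (color id (s_locality A #|G|) (phases C #|G|) bit v * id_bound #|G| + id v)%N.

Definition key_bound n := ((phases C n).+1 * id_bound n)%N.

Definition inst_key (I : instance X) (v : I) : nat :=
  cluster_key (@i_id X I) (phase_bits (phases C #|I|) (@i_coin X I)) v.

Definition key_rounds n := (phases C n * s_locality A n)%N.

(** The radius from [decreasing_chain_within]. *)
Definition chain_bound n :=
  (phases C n * (phases C n * s_locality A n + s_locality A n +
                 phases C n * s_locality A n))%N.

Definition simulation_rounds n :=
  (maxn (key_rounds n) 1 + s_locality A n + chain_bound n)%N.

Lemma inst_key_sim (I I' : instance X) (v : I) (v' : I') :
  sim (key_rounds #|I|) v v' -> inst_key v = inst_key v'.
Proof.
move=> vv'; have n' := sim_card vv'; rewrite /inst_key /cluster_key -n'.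
rewrite (sim_id vv'); congr (_ * _ + _)%N.
exact: (color_sim (phases_gt0 _ _) vv').
Qed.

Definition simulated_output (I : instance X) (v : I) : Y :=
  (ball_run A inst_key chain_bound (key_bound #|I|) v).2.

Lemma simulation_exists : exists2 A' : local_alg X Y,
  l_rounds A' = simulation_rounds &
  forall (I : instance X) (v : I),
    local_output A' (@i_id X I) (@i_in X I) (@i_coin X I) v = simulated_output v.
Proof.
(* A step on an empty view shows that [Y] is inhabited. *)
pose y0 := (@s_step _ _ A 0 0 (fun=> false) (View (fun=> None) (fun _ _ => false))).2.
apply: (local_alg_of_sim y0) => I I' v v' vv'.
have n' := sim_card vv'; rewrite /simulated_output -n'; congr snd.
exact: (ball_run_sim inst_key_sim).
Qed.

Section OneGraph.
Variables (G : sgraph) (id : G -> nat) (x : G -> X).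
Hypothesis idP : identifiers b id.
Let M := phases C #|G|.
Let r := s_locality A #|G|.
Implicit Types (bit : G -> nat -> nat -> bool) (u v : G).

Lemma cluster_key_inj bit : injective (cluster_key id bit).
Proof.
move=> u v /(congr1 (modn^~ (id_bound #|G|))).
by rewrite !modnMDl !modn_small ?idP.2 // => /idP.1.
Qed.

Lemma cluster_key_leq bit v : (cluster_key id bit v <= key_bound #|G|)%N.
Proof.
rewrite /cluster_key /key_bound mulSn addnC; apply: leq_add.
  exact: ltnW (idP.2 v).
by rewrite leq_mul2r color_leqM orbT.
Qed.

Lemma color_mono bit u v : (cluster_key id bit u < cluster_key id bit v)%N ->
  (color id r M bit u <= color id r M bit v)%N.
Proof.
rewrite /cluster_key -/M -/r => kuv; rewrite leqNgt; apply/negP => cvu.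
have : ((color id r M bit v).+1 * id_bound #|G| <= color id r M bit u * id_bound #|G|)%N.
  by rewrite leq_mul2r cvu orbT.
by have := idP.2 v; rewrite -/(id_bound #|G|) mulSn; lia.
Qed.

Definition cluster_order bit : seq G :=
  sort (fun u v => cluster_key id bit u <= cluster_key id bit v)%N (enum G).

Lemma cluster_order_perm bit : perm_eq (cluster_order bit) (enum G).
Proof. by rewrite /cluster_order perm_sort. Qed.

Lemma cluster_order_sorted bit :
  sorted (fun u v => cluster_key id bit u < cluster_key id bit v)%N (cluster_order bit).
Proof.
have le_total : total (fun u v => cluster_key id bit u <= cluster_key id bit v)%N.
  by move=> u v; exact: leq_total.
have := sort_sorted le_total (enum G); rewrite -/(cluster_order bit).
have uniq_order : uniq (cluster_order bit) by rewrite sort_uniq enum_uniq.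
have -> : sorted (fun u v => cluster_key id bit u < cluster_key id bit v)%N
    (cluster_order bit) = sorted ltn (map (cluster_key id bit) (cluster_order bit)).
  by rewrite sorted_map.
rewrite ltn_sorted_uniq_leq map_inj_uniq; last exact: cluster_key_inj.
by rewrite uniq_order sorted_map.
Qed.

(** For a good table every key-decreasing chain from [v] stays within [chain_bound], so restricting
    the run to that ball does not change the output at [v]. *)
Lemma simulated_output_slocal (w : G * nat -> bool) y :
  let rho := [ffun j => w (table_coin j)] : phase_table G M in
  ~~ fails_to_cluster id r rho ->
  slocal_outputs A id x (fun i => w (i.1, i.2.*2))
    (cluster_order (table_bits rho)) y ->
  forall v, @simulated_output (Instance x w idP.1) v = y v.
Proof.
move=> rho; rewrite negb_or => /andP[/existsPn nall /existsPn ncol] out v.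
have bit0 u p : (p < M)%N -> ~~ all (table_bits rho u p) (iota 0 M).
  by move=> pM; have /existsPn/(_ (Ordinal pM)) := nall u.
have color_lt u : (color id r M (table_bits rho) u < M)%N.
  by rewrite ltn_neqAle ncol color_leqM.
have := out v; rewrite (@slocal_run_keyed _ _ _ _ _ _ _
  (cluster_key id (table_bits rho)) _ (key_bound #|G|)) => [[<-]||u|u]; first last.
- exact: cluster_key_leq.
- by rewrite (perm_mem (cluster_order_perm _)) mem_enum.
- exact: cluster_order_sorted.
rewrite /simulated_output /ball_run /inst_key /= phase_bits_table -/M -/rho.
rewrite keyed_run_reachable // => q vq.
apply: (decreasing_chain_within (phases_gt0 _ _) idP.1 bit0 color_lt).
by apply: sub_path vq => u z /andP[-> /color_mono].
Qed.

End OneGraph.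
End Simulation.

Theorem theorem1p11 (R : realType) (b : nat) (eps : nat -> R) (c : R)
    (heps : forall n, 0 <= eps n) (hc : 0 < c) :
  forall P : problem,
    P_RSLOCAL b eps P -> P_RLOCAL b (fun n => eps n + 1 / n%:R `^ c) P.
Proof.
move=> P [t t_polylog [A [At AP]]].
(* A natural exponent above [c], so that [n ^ C] dominates the real power. *)
pose C := (Num.truncn c).+1.
have [A' roundsA' A'E] := simulation_exists A b C.
pose m n := phases C n.
(* This is [simulation_rounds] with the locality replaced by its bound [t] and the maximum by a
   sum. *)
exists (fun n => m n * t n + 1 + t n + m n * (m n * t n + t n + m n * t n))%N.
  have m_polylog : polylog R m.
    apply: polylogM (polylog_cst R 2) _; apply: polylogM (polylog_cst R _) _.
    have -> : (fun n => (trunc_log 2 n).+1) = (fun n => trunc_log 2 n + 1)%N.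
      by apply: funext => n; rewrite addn1.
    exact: polylogD (polylog_trunc_log R) (polylog_cst R 1).
  have mt := polylogM m_polylog t_polylog.
  apply: polylogD; first exact: polylogD (polylogD mt (polylog_cst R 1)) t_polylog.
  exact: polylogM m_polylog (polylogD (polylogD mt t_polylog) mt).
exists A'; split=> [n|G id x idP].
  rewrite roundsA' /simulation_rounds /key_rounds /chain_bound -/(m n).
  have mt : (m n * s_locality A n <= m n * t n)%N by rewrite leq_mul2l At orbT.
  apply: leq_add; first apply: leq_add (At n).
    by rewrite geq_max leq_addl andbT (leq_trans mt) ?leq_addr.
  by rewrite leq_mul2l (leq_add (leq_add mt (At n)) mt) orbT.
set n := #|G|; set M := phases C n.
have n0 : (0 < n)%N := vert_gt0 G.
pose bad := @fails_to_cluster G id (s_locality A n) M.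
apply: (@prob_le_weaken _ _ _ (eps n + #|bad|%:R / #|{: phase_table G M}|%:R)).
  rewrite lerD2l.
  have T0 : (0 < #|{: phase_table G M}|)%N.
    by rewrite card_ffun card_bool expn_gt0.
  have nC : n%:R `^ c <= n%:R ^+ C :> R.
    rewrite -powR_mulrn // ler_powR ?ler1n // ltW //; exact: truncnS_gt.
  rewrite ler_pdivrMr ?ltr0n // mulrAC ler_pdivlMr ?powR_gt0 ?ltr0n // mul1r.
  apply: (@le_trans _ _ (#|bad|%:R * n%:R ^+ C)); first by rewrite ler_wpM2l.
  rewrite -natrX -natrM ler_nat -(leq_pmul2r (expn_gt0 2 M)).
  have cb := card_fails_to_cluster id (s_locality A n) (phases_gt0 C n).
  rewrite cardsE in cb.
  apply: (@leq_trans (n * M.+1 * n ^ C * #|{: phase_table G M}|)).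
    rewrite mulnAC [leqRHS]mulnAC leq_mul2r; apply/orP; right; exact: cb.
  by rewrite [leqRHS]mulnC leq_mul2r leq_exp_phases ?orbT.
have ev_inj : injective (fun i : G * nat => (i.1, i.2.*2)).
  by move=> [u i] [v j] [-> /(congr1 half)]; rewrite !doubleK => ->.
apply: (prob_le_split ev_inj (@table_coin_inj G M) _ (bad := bad)
  (F' := fun rho => [set w | ~ exists2 y,
     slocal_outputs A id x w (cluster_order A b C id (table_bits rho)) y &
     p_valid x y])) => //.
- by move=> i j [_ /(congr1 odd)]; rewrite /= !odd_double.
- by move=> rho _; apply: AP => //; exact: cluster_order_perm.
move=> w /= invalid; case: (boolP (bad _)) => [|good]; first by left.
(* Valid SLOCAL outputs along this order would coincide with the simulated ones. *)
right=> -[y out valid]; apply: invalid.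
suff -> : local_output A' id x w = y by [].
apply: funext => v; rewrite -(simulated_output_slocal idP good out).
exact: (A'E (Instance x w idP.1)).
Qed.
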